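(* Let $u:M\to M$ be invertible, let $(X^\kappa,M,\pi)$, $\kappa=s,c,u$, be bundles with metric fibers, $X=X^s\times X^c\times X^u$, and let $H:X\to X$ be a bundle correspondence over $u$ satisfying the trichotomy hypothesis (HT) of the context and possessing a $1$-pseudo-invariant section. Assume moreover that $H$ is invertible, i.e. for every $m\in M$, $H_m:X_m\to X_{u(m)}$ is an invertible map. Then there are bundle maps $h^s:X^{cs}\to X^s$, $h^u:X^{cu}\to X^u$ and $h^c:X^c\to X^c$ over $u$ and an invertible bundle map $\Pi:X\to X$ over $\mathrm{id}$ such that $$\Pi\circ H=(h^s\times h^c\times h^u)\circ\Pi,$$ where $(h^s\times h^c\times h^u)_m(x^s,x^c,x^u)=(h^s_m(x^s,x^c),h^c_m(x^c),h^u_m(x^c,x^u))$ for $(x^s,x^c,x^u)\in X^s_m\times X^c_m\times X^u_m$.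
   Context: A bundle with metric fibers $(X,M,\pi)$ is a surjection $\pi:X\to M$ of sets such that every fiber $X_m$ is a complete metric space; metrics are written $|x-y|$. $X^{\kappa_1\kappa_2}=X^{\kappa_1}\times X^{\kappa_2}$ has fibers $X^{\kappa_1}_m\times X^{\kappa_2}_m$ with the max metric. A bundle map over $w:M\to M$ is a family of maps from the fiber over $m$ to the fiber over $w(m)$. A correspondence $H:A\to B$ is a nonempty subset $\operatorname{Graph}H\subset A\times B$; $H(a)=\{b:(a,b)\in\operatorname{Graph}H\}$. $H:X_1\times Y_1\to X_2\times Y_2$ has generating map $(F,G)$ ($H\sim(F,G)$), $F:X_1\times Y_2\to X_2$, $G:X_1\times Y_2\to Y_1$, if $(x_2,y_2)\in H(x_1,y_1)\iff y_1=G(x_1,y_2),x_2=F(x_1,y_2)$. A bundle correspondence over $u$ is a family $H_m:X_m\to X_{u(m)}$ of correspondences. (A)$(\alpha,\lambda_u)$ (B)$(\beta,\lambda_s)$ condition for $H_m\sim(F_m,G_m)$: for all $(x_1,y_1)\times(x_2,y_2)$, $(x_1',y_1')\times(x_2',y_2')\in\operatorname{Graph}H_m$: if $|x_1-x_1'|\le\alpha(m)|y_1-y_1'|$ then $|x_2-x_2'|\le\alpha(m)|y_2-y_2'|$ and $|y_1-y_1'|\le\lambda_u(m)|y_2-y_2'|$; if $|y_2-y_2'|\le\beta(m)|x_2-x_2'|$ then $|y_1-y_1'|\le\beta(m)|x_1-x_1'|$ and $|x_2-x_2'|\le\lambda_s(m)|x_1-x_1'|$. (HT): $H$ has generating bundle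 maps $(F^{cs},G^{cs})$, $F^{cs}_m:X^{cs}_m\times X^u_{u(m)}\to X^{cs}_{u(m)}$, $G^{cs}_m:X^{cs}_m\times X^u_{u(m)}\to X^u_m$ (splitting $X^{cs}\times X^u$), and $(F^{cu},G^{cu})$, $F^{cu}_m:X^s_m\times X^{cu}_{u(m)}\to X^s_{u(m)}$, $G^{cu}_m:X^s_m\times X^{cu}_{u(m)}\to X^{cu}_m$ (splitting $X^s\times X^{cu}$). $H\sim(F^{cs},G^{cs})$ satisfies the (A)$(\alpha_u,\lambda_u)$ (B)$(\beta_{cs},\lambda_{cs})$ condition and $H\sim(F^{cu},G^{cu})$ satisfies the (A)$(\alpha_{cu},\lambda_{cu})$ (B)$(\beta_s,\lambda_s)$ condition, with all $\alpha_\kappa,\beta_\kappa,\lambda_\kappa$ bounded functions $M\to\mathbb R_+$ and: (a) $\sup_m\alpha_u(m)\beta_{cs}(u(m))<1$, $\sup_m\alpha_{cu}(m)\beta_s(u(m))<1$; $\alpha_{\kappa_1}(m)\le\alpha_{\kappa_1}(u(m))$, $\beta_{\kappa_2}(u(m))\le\beta_{\kappa_2}(m)$ for $\kappa_1=u,cu$, $\kappa_2=s,cs$; (a$'$) $\alpha_{cu}(m)\le1$, $\beta_{cs}(m)\le1$, $\beta_{cs}(m)\le\beta_s(m)$, $\alpha_{cu}(m)\le\alpha_u(m)$, $\sup_m\alpha_u(m)\beta_s(m)<1$; (b) $\sup_m\lambda_u(m)\lambda_{cs}(m)<1$, $\sup_m\lambda_u(m)<1$, $\sup_m\lambda_{cu}(m)\lambda_s(m)<1$,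 $\sup_m\lambda_s(m)<1$. For $H\sim(F,G)$ on a splitting $X\times Y$, a section $i=(i_X,i_Y)$ is $1$-pseudo-invariant if there is $\eta:M\to\mathbb R_+$ with $|i_X(u(m))-F_m(i_X(m),i_Y(u(m)))|\le\eta(u(m))$, $|i_Y(m)-G_m(i_X(m),i_Y(u(m)))|\le\eta(m)$, $\eta(u(m))\le\eta(m)$ and $\eta(m)\le\eta(u(m))$ for all $m$. Here this is required for both generating bundle maps. *)

(* Defs.v *)
From HB Require Import structures.
From mathcomp Require Import all_boot all_order all_algebra.
From mathcomp Require Import all_classical all_reals all_analysis.

Set Implicit Arguments.
Unset Strict Implicit.
Unset Printing Implicit Defensive.

Import Order.TTheory GRing.Theory Num.Theory.
Local Open Scope classical_set_scope.
Local Open Scope ring_scope.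

(* The library has the product pseudometric but not the product metric. Its
   product balls are the balls of the max metric, which is what the instance
   below records. *)
Section prod_metric.
Context {R : realFieldType} {T U : metricType R}.
Implicit Types x y : T * U.

Let dist x y : R := Num.max (mdist x.1 y.1) (mdist x.2 y.2).

Let dist_ge0 x y : 0 <= dist x y.
Proof. by rewrite /dist le_max mdist_ge0. Qed.

Let dist_positivity x y : dist x y = 0 -> x = y.
Proof.
move=> xy; have : dist x y <= 0 by rewrite xy.
rewrite /dist ge_max => /andP[h1 h2].
case: x y {xy} h1 h2 => [x1 x2] [y1 y2] /= h1 h2; congr pair.
- by apply: mdist_positivity; apply/eqP; rewrite eq_le h1 mdist_ge0.
- by apply: mdist_positivity; apply/eqP; rewrite eq_le h2 mdist_ge0.
Qed.

Let ballEdist x d : ball x d = [set y | dist x y < d].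
Proof.
apply/seteqP; split => y; rewrite /ball /= /prod_ball !ballEmdist /= /dist gt_max.
  by case=> -> ->.
by case/andP.
Qed.

HB.instance Definition _ := @PseudoMetric_isMetric.Build R (T * U)%type
  dist dist_ge0 dist_positivity ballEdist.

End prod_metric.

Section prod_complete.
Context {T U : completeType}.

HB.saturate prod.

Lemma prod_cauchy_cvg (F : set_system (T * U)) :
  ProperFilter F -> cauchy F -> cvg F.
Proof.
move=> FF cF.
have cT : cauchy (fst @ F).
  move=> A entA; have : entourage [set q : (T * U) * (T * U) | A (q.1.1, q.2.1)].
    exists (A, setT) => /=; first by split=> //; exact: entourageT.
    by move=> [[a b] [c d]] [/= Aab _]; exists ((a, c), (b, d)).
  move=> /cF [[P Q] /= [FP FQ] PQ]; exists ([set fst x | x in P], [set fst x | x in Q]).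
    split=> /=; [apply: filterS FP|apply: filterS FQ] => x Px;
    by exists x.
  by move=> [_ _] [/= [x Px <-] [y Qy <-]]; exact: (PQ (x, y)).
have cU : cauchy (snd @ F).
  move=> A entA; have : entourage [set q : (T * U) * (T * U) | A (q.1.2, q.2.2)].
    exists (setT, A) => /=; first by split=> //; exact: entourageT.
    by move=> [[a b] [c d]] [/= _ Acd]; exists ((a, c), (b, d)).
  move=> /cF [[P Q] /= [FP FQ] PQ]; exists ([set snd x | x in P], [set snd x | x in Q]).
    split=> /=; [apply: filterS FP|apply: filterS FQ] => x Px;
    by exists x.
  by move=> [_ _] [/= [x Px <-] [y Qy <-]]; exact: (PQ (x, y)).
have Fa := @cauchy_cvg _ _ (fmap_proper_filter fst FF) cT.
have Fb := @cauchy_cvg _ _ (fmap_proper_filter snd FF) cU.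
apply: (@cvgP _ _ (lim (fst @ F), lim (snd @ F))) => A [[P Q] /= [aP bQ] PQA].
have {}aP : F (fst @^-1` P) := Fa _ aP.
have {}bQ : F (snd @^-1` Q) := Fb _ bQ.
suff : F A by [].
by apply: filterS (filterI aP bQ) => -[x y] [/= Px Qy]; exact: (PQA (x, y)).
Qed.

HB.instance Definition _ := Uniform_isComplete.Build (T * U)%type prod_cauchy_cvg.

End prod_complete.

#[short(type="completeMetricType")]
HB.structure Definition CompleteMetric (K : numFieldType) :=
  { T of Metric K T & CompletePseudoMetric K T }.

HB.saturate prod.

(* A bundle with metric fibers over M is encoded by the family X : M -> _ of
   its fibers. The base point carried by completeMetricType plays the role of
   the surjectivity of the projection: it says that no fiber is empty. *)

Definition prod_bundle (R : realFieldType) (M : Type) (X Y : M -> completeMetricType R)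
  : M -> completeMetricType R := fun m => (X m * Y m)%type.

Definition bundle_map (R : realFieldType) (M : Type) (w : M -> M)
  (X Y : M -> completeMetricType R) : Type := forall m, X m -> Y (w m).

Record correspondence (A B : Type) := Correspondence {
  Graph : set (A * B);
  Graph_neq0 : Graph !=set0 }.

Definition bundle_correspondence (R : realFieldType) (M : Type) (u : M -> M)
  (X Y : M -> completeMetricType R) : Type :=
  forall m, correspondence (X m) (Y (u m)).

Definition map_graph (A B : Type) (f : A -> B) : set (A * B) :=
  [set p | p.2 = f p.1].

Definition invertible_correspondence (A B : Type) (H : correspondence A B) :=
  exists2 f : A -> B, bijective f & Graph H = map_graph f.

(* A triple product is left-nested, hence already split as X^cs * X^u; this is
   the same correspondence seen in the splitting X^s * X^cu. *)
Definition assoc_graph (A1 B1 C1 A2 B2 C2 : Type)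
    (H : set ((A1 * B1 * C1) * (A2 * B2 * C2))) :
    set ((A1 * (B1 * C1)) * (A2 * (B2 * C2))) :=
  [set p | H ((p.1.1, p.1.2.1, p.1.2.2), (p.2.1, p.2.2.1, p.2.2.2))].

Lemma assoc_graph_neq0 (A1 B1 C1 A2 B2 C2 : Type)
    (H : correspondence (A1 * B1 * C1) (A2 * B2 * C2)) :
  assoc_graph (Graph H) !=set0.
Proof.
by case: H => G [[[[a1 b1] c1] [[a2 b2] c2]] G12];
  exists ((a1, (b1, c1)), (a2, (b2, c2))).
Qed.

Definition assoc_correspondence (A1 B1 C1 A2 B2 C2 : Type)
    (H : correspondence (A1 * B1 * C1) (A2 * B2 * C2)) :
    correspondence (A1 * (B1 * C1)) (A2 * (B2 * C2)) :=
  Correspondence (assoc_graph_neq0 H).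

Section generating_maps.
Context {R : realFieldType} {X1 Y1 X2 Y2 : metricType R}.

Definition generating_map (H : correspondence (X1 * Y1) (X2 * Y2))
    (F : X1 * Y2 -> X2) (G : X1 * Y2 -> Y1) : Prop :=
  forall x1 y1 x2 y2,
    Graph H ((x1, y1), (x2, y2)) <-> y1 = G (x1, y2) /\ x2 = F (x1, y2).

Definition A_condition (alpha lambda : R)
    (H : correspondence (X1 * Y1) (X2 * Y2)) : Prop :=
  forall x1 y1 x2 y2 x1' y1' x2' y2',
    Graph H ((x1, y1), (x2, y2)) -> Graph H ((x1', y1'), (x2', y2')) ->
    mdist x1 x1' <= alpha * mdist y1 y1' ->
    mdist x2 x2' <= alpha * mdist y2 y2' /\
    mdist y1 y1' <= lambda * mdist y2 y2'.

Definition B_condition (beta lambda : R)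
    (H : correspondence (X1 * Y1) (X2 * Y2)) : Prop :=
  forall x1 y1 x2 y2 x1' y1' x2' y2',
    Graph H ((x1, y1), (x2, y2)) -> Graph H ((x1', y1'), (x2', y2')) ->
    mdist y2 y2' <= beta * mdist x2 x2' ->
    mdist y1 y1' <= beta * mdist x1 x1' /\
    mdist x2 x2' <= lambda * mdist x1 x1'.

End generating_maps.

Section bundles.
Context {R : realType} {M : Type} (u : M -> M).

Definition bounded_nonneg (f : M -> R) : Prop :=
  (forall m, 0 <= f m) /\ has_ubound (range f).

Definition generating_bundle_map (X Y : M -> completeMetricType R)
    (H : bundle_correspondence u (prod_bundle X Y) (prod_bundle X Y))
    (F : forall m, X m * Y (u m) -> X (u m))
    (G : forall m, X m * Y (u m) -> Y m) : Prop :=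
  forall m, generating_map (H m) (F m) (G m).

Definition AB_condition (X Y : M -> completeMetricType R)
    (alpha lambda_u beta lambda_s : M -> R)
    (H : bundle_correspondence u (prod_bundle X Y) (prod_bundle X Y)) : Prop :=
  forall m, A_condition (alpha m) (lambda_u m) (H m) /\
            B_condition (beta m) (lambda_s m) (H m).

Definition pseudo_invariant1 (X Y : M -> completeMetricType R)
    (F : forall m, X m * Y (u m) -> X (u m))
    (G : forall m, X m * Y (u m) -> Y m)
    (iX : forall m, X m) (iY : forall m, Y m) : Prop :=
  exists eta : M -> R,
    (forall m, 0 <= eta m) /\
    forall m,
      [/\ mdist (iX (u m)) (F m (iX m, iY (u m))) <= eta (u m),
          mdist (iY m) (G m (iX m, iY (u m))) <= eta m,
          eta (u m) <= eta m & eta m <= eta (u m)].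

Section triple.
Variables Xs Xc Xu : M -> completeMetricType R.

Definition bundle_cs := prod_bundle Xs Xc.
Definition bundle_cu := prod_bundle Xc Xu.
Definition bundle_scu := prod_bundle bundle_cs Xu.

Definition assoc_bundle_correspondence
    (H : bundle_correspondence u bundle_scu bundle_scu) :
    bundle_correspondence u (prod_bundle Xs bundle_cu)
                            (prod_bundle Xs bundle_cu) :=
  fun m => assoc_correspondence (H m).

Definition trichotomy
    (H : bundle_correspondence u bundle_scu bundle_scu)
    (Fcs : forall m, bundle_cs m * Xu (u m) -> bundle_cs (u m))
    (Gcs : forall m, bundle_cs m * Xu (u m) -> Xu m)
    (Fcu : forall m, Xs m * bundle_cu (u m) -> Xs (u m))
    (Gcu : forall m, Xs m * bundle_cu (u m) -> bundle_cu m)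
    (alpha_u alpha_cu beta_s beta_cs
     lambda_u lambda_cu lambda_s lambda_cs : M -> R) : Prop :=
  [/\ [/\ generating_bundle_map H Fcs Gcs,
          generating_bundle_map (assoc_bundle_correspondence H) Fcu Gcu,
          AB_condition alpha_u lambda_u beta_cs lambda_cs H &
          AB_condition alpha_cu lambda_cu beta_s lambda_s
            (assoc_bundle_correspondence H)],
      [/\ bounded_nonneg alpha_u /\ bounded_nonneg alpha_cu,
          bounded_nonneg beta_s /\ bounded_nonneg beta_cs,
          bounded_nonneg lambda_u /\ bounded_nonneg lambda_cu &
          bounded_nonneg lambda_s /\ bounded_nonneg lambda_cs],
      [/\ sup (range (fun m => alpha_u m * beta_cs (u m))) < 1,
          sup (range (fun m => alpha_cu m * beta_s (u m))) < 1,
          forall m, alpha_u m <= alpha_u (u m) /\ alpha_cu m <= alpha_cu (u m) &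
          forall m, beta_s (u m) <= beta_s m /\ beta_cs (u m) <= beta_cs m],
      (forall m, [/\ alpha_cu m <= 1, beta_cs m <= 1, beta_cs m <= beta_s m &
                     alpha_cu m <= alpha_u m]) /\
      sup (range (fun m => alpha_u m * beta_s m)) < 1 &
      [/\ sup (range (fun m => lambda_u m * lambda_cs m)) < 1,
          sup (range lambda_u) < 1,
          sup (range (fun m => lambda_cu m * lambda_s m)) < 1 &
          sup (range lambda_s) < 1]].

Definition decoupled_map (hs : bundle_map u bundle_cs Xs)
    (hc : bundle_map u Xc Xc) (hu : bundle_map u bundle_cu Xu) :
    bundle_map u bundle_scu bundle_scu :=
  fun m x => (hs m (x.1.1, x.1.2), hc m x.1.2, hu m (x.1.2, x.2)).

End triple.
End bundles.
Arguments decoupled_map {R M u Xs Xc Xu} hs hc hu m x.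

(* Main.v *)
Require Import Defs.
From HB Require Import structures.
From mathcomp Require Import all_boot all_order all_algebra.
From mathcomp Require Import all_classical all_reals all_analysis.
From mathcomp Require Import ring lra.

(* Write phi for the bijections underlying H. Call two points cs-equivalent
   (resp. s-equivalent, u-equivalent) if the distance of their forward (resp.
   forward, backward) iterates grows at most like the product of the rates
   lambda_cs (resp. lambda_s, lambda_u) along the base orbit, each rate being
   slightly enlarged. The classes form phi-invariant laminations of the fibers.
   By the graph transform, each class is the graph of a Lipschitz function:
   cs-classes over X^s x X^c, s-classes over X^s, u-classes over X^u. An
   s-class lies in a cs-class, and a u-class meets a cs-class in one point
   because alpha_u beta_cs < 1. The pseudo-invariant section is tracked by the
   points of one cs-class L in every fiber, and phi maps L to L.
     Now send z to (x^s, x^c, x^u), where p is the point of L in the u-class of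
   z, x^s is the s-coordinate of p, x^c labels the s-class of p inside L, and
   x^u labels the cs-class of z. The pair (x^s, x^c) determines p, hence the
   u-class of z, so this is a bijection; each of (x^s, x^c), x^c and x^u is a
   quotient of the dynamics by an invariant relation. *)

Set Implicit Arguments.
Unset Strict Implicit.
Unset Printing Implicit Defensive.

Import Order.TTheory GRing.Theory Num.Theory.
Local Open Scope classical_set_scope.
Local Open Scope ring_scope.

(** * Distances and geometric convergence in complete metric spaces *)

Section mdist_theory.
Context {R : realType} {T : completeMetricType R}.
Implicit Types x y z : T.

(* The originals are stated along another coercion path from realType, on which
   lra does not identify the distances. *)
Lemma mdist_tri x y z : mdist x z <= mdist x y + mdist y z.
Proof. exact: metric_triangle. Qed.

Lemma mdistC x y : mdist x y = mdist y x.
Proof. exact: metric_sym. Qed.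

Lemma mdist_pair (U : completeMetricType R) (z z' : T * U) :
  mdist z z' = Num.max (mdist z.1 z'.1) (mdist z.2 z'.2).
Proof. by []. Qed.

End mdist_theory.

Section geometric.
Context {R : realType}.
Implicit Types rho c e x k : R.

Lemma geometric_small rho c e : 0 <= rho < 1 -> 0 < e ->
  exists n, forall j, (n <= j)%N -> rho ^+ j * c < e.
Proof.
move=> /andP[rho0 rho1] e0; have := @cvg_geometric R c rho.
rewrite ger0_norm// => /(_ rho1) /cvgr0Pnorm_lt /(_ e e0) [n _ nP].
exists n => j nj; rewrite mulrC; apply: le_lt_trans (nP j nj); exact: ler_norm.
Qed.

Lemma geometric_le0 rho c x : 0 <= rho < 1 ->
  (forall n, x <= rho ^+ n * c) -> x <= 0.
Proof.
move=> rho01 H; rewrite leNgt; apply/negP => x0.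
have [n /(_ n (leqnn n))] := geometric_small c rho01 x0.
by rewrite ltNge H.
Qed.

Lemma geometric_cvg (T : completeMetricType R) (u : nat -> T) rho c :
  0 <= rho < 1 ->
  (forall n j, mdist (u n) (u (n + j)%N) <= rho ^+ n * c) ->
  exists l, forall n, mdist (u n) l <= rho ^+ n * c.
Proof.
move=> rho01 H.
have /cvg_ex[/= l ul] : cvg (u @ \oo).
  apply: cauchy_cvg; apply/cauchy_exP => e e0.
  have [n nP] := geometric_small c rho01 e0.
  exists (u n), n => //= j nj; rewrite ballEmdist /=.
  by rewrite -(subnKC nj); apply: le_lt_trans (H _ _) (nP n _).
exists l => n; rewrite -subr_le0; apply/ler_addgt0Pr => e e0.
have /cvg_ballP/(_ e e0) [k _ kP] := ul.
have := kP (n + k)%N (leq_addl _ _); rewrite /= ballEmdist /= metric_sym => ukl.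
by have := metric_triangle (u n) (u (n + k)%N) l; have := H n k; lra.
Qed.

Lemma contraction_fixpoint (T : completeMetricType R) (h : T -> T) k :
  0 <= k < 1 -> (forall y z, mdist (h y) (h z) <= k * mdist y z) ->
  exists p, h p = p.
Proof.
move=> /andP[k0 k1] hk; pose y0 : T := point.
have k1' : 0 < 1 - k by lra.
pose u n := iter n h y0; pose D := mdist y0 (h y0) / (1 - k).
have D0 : 0 <= D by rewrite divr_ge0 ?mdist_ge0 ?ltW.
have uD j : mdist y0 (u j) <= D.
  elim: j => [|j IH]; first by rewrite mdistxx.
  have := metric_triangle y0 (h y0) (u j.+1); have := hk y0 (u j).
  have : mdist y0 (h y0) = (1 - k) * D by rewrite /D mulrC divfK ?gt_eqF.
  rewrite /=; nra.
have uC n j : mdist (u n) (u (n + j)%N) <= k ^+ n * D.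
  elim: n => [|n IH]; first by rewrite expr0 mul1r.
  rewrite addSn exprS -mulrA; apply: le_trans (hk _ _) _.
  exact: ler_wpM2l.
have k01 : 0 <= k < 1 by rewrite k0.
have [l lP] := geometric_cvg k01 uC.
exists l; apply: mdist_positivity; apply/eqP; rewrite eq_le mdist_ge0 andbT.
apply: (@geometric_le0 k (2 * k * D)) => // n.
have := metric_triangle (h l) (u n.+1) l; rewrite (metric_sym (h l) (u n.+1)).
have := hk (u n) l; have := ler_wpM2l k0 (lP n); have := lP n.+1.
by rewrite /= exprS; set a := k ^+ n; lra.
Qed.

End geometric.

(** * Invariant graphs of dichotomies *)

(** The first clause keeps only solvability from the generating maps. Uniqueness of the solution
    follows from the second clause when [alpha] is nonnegative. *)
Definition dichotomy (R : realType) (I : Type) (s : I -> I)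
    (X Y : I -> completeMetricType R)
    (phi : forall i, X i * Y i -> X (s i) * Y (s i))
    (alpha beta lu ls : I -> R) : Prop :=
  [/\ forall i x y', exists y x', phi i (x, y) = (x', y'),
      forall i z z', mdist z.1 z'.1 <= alpha i * mdist z.2 z'.2 ->
        mdist (phi i z).1 (phi i z').1 <=
          alpha i * mdist (phi i z).2 (phi i z').2 /\
        mdist z.2 z'.2 <= lu i * mdist (phi i z).2 (phi i z').2 &
      forall i z z',
        mdist (phi i z).2 (phi i z').2 <=
          beta i * mdist (phi i z).1 (phi i z').1 ->
        mdist z.2 z'.2 <= beta i * mdist z.1 z'.1 /\
        mdist (phi i z).1 (phi i z').1 <= ls i * mdist z.1 z'.1].

(* [mu] is the growth rate allowed along a leaf; it may exceed the contraction
   rate [ls] of the X-coordinate as long as [lu * mu] stays below 1. *)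
Record hyperbolic (R : realType) (I : Type) (s : I -> I)
    (X Y : I -> completeMetricType R)
    (phi : forall i, X i * Y i -> X (s i) * Y (s i))
    (alpha beta lu ls mu : I -> R) (kappa rho B : R) : Prop := Hyperbolic {
  hyp_dichotomy : dichotomy phi alpha beta lu ls;
  hyp_B0 : 0 <= B;
  hyp_alpha : forall i, 0 <= alpha i <= B;
  hyp_beta : forall i, 0 <= beta i <= B;
  hyp_lu : forall i, 0 <= lu i <= B;
  hyp_ls : forall i, 0 <= ls i <= mu i;
  hyp_mu : forall i, 0 < mu i;
  hyp_alpha_mono : forall i, alpha i <= alpha (s i);
  hyp_beta_mono : forall i, beta (s i) <= beta i;
  hyp_kappa : forall i, alpha i * beta i <= kappa;
  hyp_kappa1 : kappa < 1;
  hyp_rho : forall i, lu i * mu i <= rho;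
  hyp_rho01 : 0 <= rho < 1 }.

(** * Leaves and tracked sections, defined by growth rates along orbits *)

Section growth.
Context {R : realType} {I : Type} (s : I -> I) (Z : I -> metricType R)
  (phi : forall i, Z i -> Z (s i)) (mu : I -> R).

(* [grow n C z z'] bounds the distance of the n-th iterates by C times the
   product of mu along the first n points of the orbit. The recursion on the
   head of the orbit avoids transports between the fibers over
   [iter n s (s i)] and [s (iter n s i)]. *)
Fixpoint grow n (C : R) i (z z' : Z i) : Prop :=
  if n is n'.+1 then grow n' (C * mu i) (phi z) (phi z')
  else mdist z z' <= C.

(** Unlike in [grow], the orbit is compared with the values of [r], which need not form an orbit. *)
Fixpoint track (r : forall i, Z i) n (C : R) i (z : Z i) : Prop :=
  if n is n'.+1 then track r n' (C * mu i) (phi z)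
  else mdist z (r i) <= C.

Definition leaf i (z z' : Z i) := exists C, forall n, grow n C z z'.

Definition tracking (r : forall i, Z i) i (z : Z i) :=
  exists C, forall n, track r n C z.

Lemma leaf_sym i (z z' : Z i) : leaf z z' -> leaf z' z.
Proof.
move=> [C H]; exists C => n; move: (H n) => {H}.
elim: n i C z z' => [|n IH] i C z z' /=; first by rewrite metric_sym.
exact: IH.
Qed.

Lemma leaf_trans i (z1 z2 z3 : Z i) : leaf z1 z2 -> leaf z2 z3 -> leaf z1 z3.
Proof.
move=> [C H] [C' H']; exists (C + C') => n; move: (H n) (H' n) => {H H'}.
elim: n i C C' z1 z2 z3 => [|n IH] i C C' z1 z2 z3 /=.
  by move=> H H'; apply: le_trans (metric_triangle _ z2 _) (lerD H H').
by rewrite mulrDl; exact: IH.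
Qed.

Lemma tracking_leaf r i (z z' : Z i) : tracking r z -> tracking r z' -> leaf z z'.
Proof.
move=> [C H] [C' H']; exists (C + C') => n; move: (H n) (H' n) => {H H'}.
elim: n i C C' z z' => [|n IH] i C C' z z' /=.
  move=> H H'; apply: le_trans (metric_triangle _ (r i) _) _.
  by rewrite (metric_sym (r i)) lerD.
by rewrite mulrDl; exact: IH.
Qed.

Lemma leaf_tracking r i (z z' : Z i) : leaf z z' -> tracking r z -> tracking r z'.
Proof.
move=> [C H] [C' H']; exists (C + C') => n; move: (H n) (H' n) => {H H'}.
elim: n i C C' z z' => [|n IH] i C C' z z' /=.
  move=> H H'; apply: le_trans (metric_triangle _ z _) _.
  by rewrite (metric_sym z') lerD.
by rewrite mulrDl; exact: IH.
Qed.

Hypothesis mu_gt0 : forall i, 0 < mu i.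

(** Backwards, the constant is divided by the positive [mu i] and enlarged to cover the initial
    distance. *)
Lemma leaf_step i (z z' : Z i) : leaf z z' <-> leaf (phi z) (phi z').
Proof.
split=> [[C H]|[C H]]; first by exists (C * mu i) => n; exact: (H n.+1).
exists (Num.max (mdist z z') (C / mu i)) => -[|n] /=; first by rewrite le_max lexx.
have : C <= Num.max (mdist z z') (C / mu i) * mu i.
  by rewrite -ler_pdivrMr// le_max lexx orbT.
move: (Num.max _ _ * _) (H n) => {H}.
elim: n (s i) C (phi z) (phi z') => [|n IH] j C w w' D /=.
  exact: le_trans.
by move=> /IH H CD; apply: H; rewrite ler_pM2r.
Qed.

Lemma tracking_step r i (z : Z i) : tracking r z -> tracking r (phi z).
Proof. by move=> [C H]; exists (C * mu i) => n; exact: (H n.+1). Qed.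

Lemma le_track r n C C' i (z : Z i) : C <= C' -> track r n C z -> track r n C' z.
Proof.
elim: n i C C' z => [|n IH] i C C' z CC' /=; first by move=> /le_trans; exact.
by apply: IH; rewrite ler_pM2r.
Qed.

End growth.

(** * The graph transform and its limit *)

Section core.
Context {R : realType} {I : Type} {s : I -> I} {X Y : I -> completeMetricType R}
  {phi : forall i, X i * Y i -> X (s i) * Y (s i)}
  {alpha beta lu ls mu : I -> R} {kappa rho B : R}.
Hypothesis H : hyperbolic phi alpha beta lu ls mu kappa rho B.

Let hyp_solve : forall i x y', exists y x', phi (i := i) (x, y) = (x', y').
Proof. by case: (hyp_dichotomy H). Qed.
Let hyp_A : forall i (z z' : X i * Y i),
  mdist z.1 z'.1 <= alpha i * mdist z.2 z'.2 ->
  mdist (phi z).1 (phi z').1 <= alpha i * mdist (phi z).2 (phi z').2 /\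
  mdist z.2 z'.2 <= lu i * mdist (phi z).2 (phi z').2.
Proof. by case: (hyp_dichotomy H). Qed.
Let hyp_B : forall i (z z' : X i * Y i),
  mdist (phi z).2 (phi z').2 <= beta i * mdist (phi z).1 (phi z').1 ->
  mdist z.2 z'.2 <= beta i * mdist z.1 z'.1 /\
  mdist (phi z).1 (phi z').1 <= ls i * mdist z.1 z'.1.
Proof. by case: (hyp_dichotomy H). Qed.
Let alpha0 i : 0 <= alpha i. Proof. by case/andP: (hyp_alpha H i). Qed.
Let alphaB i : alpha i <= B. Proof. by case/andP: (hyp_alpha H i). Qed.
Let beta0 i : 0 <= beta i. Proof. by case/andP: (hyp_beta H i). Qed.
Let betaB i : beta i <= B. Proof. by case/andP: (hyp_beta H i). Qed.
Let lu0 i : 0 <= lu i. Proof. by case/andP: (hyp_lu H i). Qed.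
Let luB i : lu i <= B. Proof. by case/andP: (hyp_lu H i). Qed.
Let lsmu i : ls i <= mu i. Proof. by case/andP: (hyp_ls H i). Qed.
Let kappa1 : 0 < 1 - kappa. Proof. by rewrite subr_gt0 (hyp_kappa1 H). Qed.
Let rho0 : 0 <= rho. Proof. by case/andP: (hyp_rho01 H). Qed.
Let B0 : 0 <= B. Proof. exact: hyp_B0 H. Qed.
Let md0 (T : metricType R) (x y : T) : 0 <= mdist x y := mdist_ge0 x y.

Let ab_s i : alpha i * beta (s i) <= kappa.
Proof.
exact: le_trans (ler_wpM2l (alpha0 i) (hyp_beta_mono H i)) (hyp_kappa H i).
Qed.

Let kappa_absorb (a b c e t : R) : 0 <= b -> 0 <= c -> c * b <= kappa ->
  a <= c * e -> 0 <= e -> e <= b * a + t -> (1 - kappa) * e <= t.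
Proof.
move=> b0 c0 cb ae e0 H1.
have h1 := ler_wpM2l b0 ae; have h2 := ler_wpM2r e0 cb; lra.
Qed.

Definition lip i (g : X i -> Y i) :=
  forall x x', mdist (g x) (g x') <= beta i * mdist x x'.

(** Let [F y'] be the X-coordinate of the image of the point over [x] whose image has height [y'].
    The (A) condition makes [F] Lipschitz with constant [alpha i], so [g \o F] is a contraction; its
    fixed point is the height of the desired image. *)
Lemma graph_transform_ex i (g : X (s i) -> Y (s i)) : lip g -> forall x,
  exists y, (phi (x, y)).2 = g (phi (x, y)).1.
Proof.
move=> gl x.
have [F FP] : {F : Y (s i) -> X (s i) &
    forall y', exists y, phi (x, y) = (F y', y')}.
  by apply: (@choice _ _ (fun y' x' => exists y, phi (x, y) = (x', y'))) => y';
     have [y [x' e]] := hyp_solve x y'; exists x', y.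
have [||y' y'P] := @contraction_fixpoint _ _ (g \o F) (Num.max kappa 0).
- by rewrite le_max lexx orbT gt_max (hyp_kappa1 H) ltr01.
- move=> y1 y2 /=; have [w1 e1] := FP y1; have [w2 e2] := FP y2.
  have [|] := hyp_A (i := i) (z := (x, w1)) (z' := (x, w2)).
    by rewrite mdistxx mulr_ge0.
  rewrite e1 e2 /= => FF _; apply: le_trans (gl _ _) _.
  apply: le_trans (ler_wpM2l (beta0 _) FF) _.
  by rewrite mulrA ler_wpM2r// mulrC le_max ab_s.
by have [y e] := FP y'; exists y; rewrite e.
Qed.

(* This is a junk value unless [g] is Lipschitz. *)
Definition graph_transform i (g : X (s i) -> Y (s i)) (x : X i) : Y i :=
  xget point [set y | (phi (x, y)).2 = g (phi (x, y)).1].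

Lemma graph_transformP i (g : X (s i) -> Y (s i)) : lip g -> forall x,
  (phi (x, graph_transform g x)).2 = g (phi (x, graph_transform g x)).1.
Proof. by move=> /graph_transform_ex gl x; exact: (@xgetPex _ point _ (gl x)). Qed.

(** The images lie on a graph of slope [beta (s i) <= beta i], which gives the premise of the (B)
    condition. *)
Lemma graph_step i (g : X (s i) -> Y (s i)) z z' : lip g ->
  (phi z).2 = g (phi z).1 -> (phi z').2 = g (phi z').1 ->
  mdist z.2 z'.2 <= beta i * mdist z.1 z'.1 /\
  mdist (phi z).1 (phi z').1 <= ls i * mdist z.1 z'.1.
Proof.
move=> gl e e'; apply: hyp_B; rewrite e e'; apply: le_trans (gl _ _) _.
by rewrite ler_wpM2r// (hyp_beta_mono H).
Qed.

Lemma graph_transform_lip i (g : X (s i) -> Y (s i)) :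
  lip g -> lip (graph_transform g).
Proof.
move=> gl x x'.
have [h _] := graph_step gl (graph_transformP gl x) (graph_transformP gl x').
exact: h.
Qed.

(** Here only [phi z] lies on the graph of [g]. The vertical distance from [phi z'] to that graph
    controls the distance of the images, because inside the cone the slope of [g] accounts for at
    most the fraction [kappa]. *)
Lemma graph_cmp i (g : X (s i) -> Y (s i)) z z' : lip g ->
  (phi z).2 = g (phi z).1 -> mdist z.1 z'.1 <= alpha i * mdist z.2 z'.2 ->
  [/\ mdist z.2 z'.2 <= lu i * mdist (phi z).2 (phi z').2,
      mdist (phi z).1 (phi z').1 <= alpha i * mdist (phi z).2 (phi z').2 &
      (1 - kappa) * mdist (phi z).2 (phi z').2
        <= mdist (g (phi z').1) (phi z').2].
Proof.
move=> gl e zz'; have [h1 h2] := hyp_A zz'; split=> //.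
apply: (kappa_absorb (b := beta (s i)) (c := alpha i) _ _ _ h1) => //.
apply: le_trans (mdist_tri _ (g (phi z').1) _) _.
by rewrite lerD2r e gl.
Qed.

Section section_graph.
Context (r : forall i, X i * Y i).

(** The constant function through [r] over the [n]-th point of the base orbit, pulled back [n]
    times. *)
Fixpoint approx n i : X i -> Y i :=
  if n is n'.+1 then graph_transform (@approx n' (s i)) else fun=> (r i).2.
Arguments approx : clear implicits.

Lemma approx_lip n i : lip (approx n i).
Proof.
elim: n i => [|n IH] i /=; last exact: graph_transform_lip.
by move=> x x'; rewrite mdistxx mulr_ge0.
Qed.

(* Points on graphs that are T-close to the section [r] move away from [r] at
   rate at most [mu], up to the additive constant [A]. *)
Definition drift (T A : I -> R) :=
  forall i (g : X (s i) -> Y (s i)), lip g ->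
  mdist (g (r (s i)).1) (r (s i)).2 <= T (s i) -> forall z,
  (phi z).2 = g (phi z).1 ->
  mdist (phi z).1 (r (s i)).1 + A (s i) <= mu i * (mdist z.1 (r i).1 + A i).

(** Follow both points for [N] steps, until [approx j] is compared with a constant function. The
    cone is preserved, so each step back contracts the vertical distance by [lu], while by [drift]
    the final distance grows at most like the product of the [mu]. Together they give [rho ^+ N]. *)
Lemma approx_cmp (T A : I -> R) N j :
  (forall i, 0 <= A i) -> drift T A ->
  (forall n, (n < N)%N -> forall i, mdist (approx n i (r i).1) (r i).2 <= T i) ->
  (forall i, mdist (approx j i (r i).1) (r i).2 <= A i) ->
  forall i xP xR,
    mdist xP xR <= alpha i * mdist (approx (N + j) i xP) (approx N i xR) ->
    (1 - kappa) * mdist (approx (N + j) i xP) (approx N i xR) <=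
    rho ^+ N * ((1 + B) * (mdist xR (r i).1 + A i)).
Proof.
move=> A0 drT EN Ej; elim: N EN => [|N IH] EN i xP xR /=.
  rewrite add0n expr0 mul1r => hx.
  apply: (kappa_absorb (b := beta i) (c := alpha i) _ _ _ hx) => //.
    exact: hyp_kappa H _.
  apply: le_trans (mdist_tri _ (approx j i (r i).1) _) _.
  have h1 := approx_lip j xP (r i).1.
  have h2 := ler_wpM2l (beta0 i) (mdist_tri xP xR (r i).1).
  have h3 := Ej i.
  have h4 := ler_wpM2r (md0 xR (r i).1) (betaB i).
  have h5 := md0 xR (r i).1; have h6 := A0 i.
  have h7 : 0 <= B * A i by rewrite mulr_ge0.
  lra.
rewrite -/(addn N j) => hx.
have lP := approx_lip (N + j) (i := s i); have lR := approx_lip N (i := s i).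
have eP := graph_transformP lP xP; have eR := graph_transformP lR xR.
have [h1 h2] := hyp_A (z := (xP, _)) (z' := (xR, _)) hx.
have := IH _ (s i) (phi (xP, graph_transform (approx (N + j) (s i)) xP)).1
  (phi (xR, graph_transform (approx N (s i)) xR)).1.
rewrite -eP -eR; move: h1 h2 => /=; set b := mdist _ (graph_transform _ _).
set b' := mdist (phi _).2 _; set D := mdist (phi _).1 _ => h1 h2 h3.
have {}h3 : (1 - kappa) * b' <=
   rho ^+ N * ((1 + B) * (mu i * (mdist xR (r i).1 + A i))).
  apply: le_trans (h3 _ _) _ => [n nN||]; first exact: EN (ltnW nN).
    by apply: le_trans h1 _; rewrite ler_wpM2r ?md0// (hyp_alpha_mono H).
  rewrite ler_wpM2l ?exprn_ge0// ler_wpM2l//.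
    by rewrite addr_ge0.
  exact: (drT i _ lR (EN N (ltnSn _) (s i)) _ eR).
have h4 := ler_wpM2l (lu0 i) h3; have h5 := ler_wpM2l (ltW kappa1) h2.
have h6 : lu i * mu i * (rho ^+ N * (1 + B) * (mdist xR (r i).1 + A i)) <=
    rho * (rho ^+ N * (1 + B) * (mdist xR (r i).1 + A i)).
  by rewrite ler_wpM2r ?(hyp_rho H)// !mulr_ge0 ?addr_ge0 ?exprn_ge0.
by rewrite exprS; move: h4 h5 h6; set a := rho ^+ N; set d := mdist xR _; lra.
Qed.

Lemma approx_limit (T A : I -> R) :
  (forall i, 0 <= A i) -> (forall i, T i <= A i) -> drift T A ->
  (forall n i, mdist (approx n i (r i).1) (r i).2 <= T i) ->
  exists f : forall i, X i -> Y i,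
    [/\ forall i, lip (f i),
        forall i x, (phi (x, f i x)).2 = f (s i) (phi (x, f i x)).1 &
        forall i, mdist (f i (r i).1) (r i).2 <= T i].
Proof.
move=> A0 TA drT E.
pose c i x := (1 - kappa)^-1 * ((1 + B) * (mdist x (r i).1 + A i)).
have cv i x : exists l, forall n, mdist (approx n i x) l <= rho ^+ n * c i x.
  apply: geometric_cvg (hyp_rho01 H) _ => n j.
  rewrite /c mulrCA ler_pdivlMl// mdistC.
  apply: (approx_cmp A0 drT) => [k _ i'|i'|]; first exact: E.
    exact: le_trans (E _ _) (TA _).
  by rewrite mdistxx mulr_ge0.
pose f i x := projT1 (cid (cv i x)).
have fP i x n : mdist (approx n i x) (f i x) <= rho ^+ n * c i x.
  by rewrite /f; case: cid.
have fl i : lip (f i).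
  move=> x x'; rewrite -subr_le0.
  apply: (@geometric_le0 _ rho (c i x + c i x')) (hyp_rho01 H) _ => n.
  have h1 := approx_lip n x x'; have h2 := fP i x n; have h3 := fP i x' n.
  have h4 := mdist_tri (f i x) (approx n i x) (f i x').
  have h5 := mdist_tri (approx n i x) (approx n i x') (f i x').
  have := mdistC (f i x) (approx n i x) => h6.
  by rewrite mulrDr; lra.
exists f; split=> // [i x|i]; last first.
  rewrite -subr_le0.
  apply: (@geometric_le0 _ rho (c i (r i).1)) (hyp_rho01 H) _ => n.
  have h1 := fP i (r i).1 n; have h2 := E n i.
  have h3 := mdist_tri (f i (r i).1) (approx n i (r i).1) (r i).2.
  rewrite (mdistC (f i _) (approx n i _)) in h3.
  by lra.
(* Both sides are limits of [approx n.+1 i x]: by [graph_cmp], the transforms of [approx n] and of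
   the limit differ over [x] by at most [lu i / (1 - kappa)] times the distance of these two
   functions at the single point [w.1]. *)
suff -> : f i x = graph_transform (f (s i)) x by exact: graph_transformP.
apply: mdist_positivity; apply/eqP; rewrite eq_le mdist_ge0 andbT.
set w := (phi (x, graph_transform (f (s i)) x)).
apply: (@geometric_le0 _ rho (c i x + B * ((1 - kappa)^-1 * c (s i) w.1))) => [|n].
  exact: hyp_rho01 H.
have [|h1 _ h2] := graph_cmp (z := (x, graph_transform (approx n (s i)) x))
  (z' := (x, graph_transform (f (s i)) x)) (approx_lip n (i := s i))
  (graph_transformP (approx_lip n (i := s i)) x).
  by rewrite mdistxx mulr_ge0.
have e := graph_transformP (fl (s i)) x.
move: h1 h2; rewrite e -/w /=.
set b := mdist (phi _).2 _ => h1 h2.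
have {h2} := le_trans h2 (fP _ _ n); rewrite -ler_pdivlMl// => h2.
have h3 := fP i x n.+1.
have h4 := mdist_tri (f i x) (approx n.+1 i x) (graph_transform (f (s i)) x).
rewrite (mdistC (f i x) (approx n.+1 i x)) in h4.
have h5 := ler_wpM2r (md0 (phi (x, graph_transform (approx n (s i)) x)).2
  (f (s i) w.1)) (luB i).
have h6 := ler_wpM2l B0 h2.
have [rr0 rr1] : 0 <= rho ^+ n.+1 * c i x /\ rho ^+ n.+1 * c i x <= rho ^+ n * c i x.
  have c0 : 0 <= c i x.
    by rewrite !mulr_ge0 ?addr_ge0 ?invr_ge0 ?(ltW kappa1).
  split; first by rewrite mulr_ge0 ?exprn_ge0.
  rewrite ler_wpM2r// exprS -[leRHS]mul1r ler_wpM2r ?exprn_ge0//.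
  by case/andP: (hyp_rho01 H) => _ /ltW.
move: h1 h3 h4 h5 h6 rr0 rr1; rewrite /= -/b => h1 h3 h4 h5 h6 rr0 rr1.
by rewrite mulrDr; move: h6; set v := (1 - kappa)^-1 => h6; lra.
Qed.

Lemma tracking_graph (T A : I -> R) (f : forall i, X i -> Y i) :
  (forall i, 0 <= A i) -> (forall i, T i <= A i) -> drift T A ->
  (forall i, lip (f i)) ->
  (forall i x, (phi (x, f i x)).2 = f (s i) (phi (x, f i x)).1) ->
  (forall i, mdist (f i (r i).1) (r i).2 <= T i) ->
  forall i x, tracking (Z := fun i => (X i * Y i)%type) phi mu r (x, f i x).
Proof.
move=> A0 TA drT fl fi fT i x; exists ((1 + B) * (mdist x (r i).1 + A i)) => n.
elim: n i x => [|n IH] i x /=.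
  have h1 := fl i x (r i).1; have h2 := fT i; have h3 := TA i; have h4 := A0 i.
  have h5 := mdist_tri (f i x) (f i (r i).1) (r i).2.
  have h6 := ler_wpM2r (md0 x (r i).1) (betaB i).
  have h7 : 0 <= B * A i by rewrite mulr_ge0.
  have h8 : 0 <= B * mdist x (r i).1 by rewrite mulr_ge0.
  have h9 := md0 x (r i).1.
  by rewrite mdist_pair ge_max /=; apply/andP; split; lra.
have := IH (s i) (phi (x, f i x)).1; rewrite -fi -surjective_pairing.
apply: (le_track (hyp_mu H)).
rewrite -mulrA ler_wpM2l ?addr_ge0// [leRHS]mulrC.
exact: (drT _ _ (fl (s i)) (fT (s i)) (x, f i x) (fi i x)).
Qed.

End section_graph.

Local Notation leafZ := (leaf (Z := fun i => (X i * Y i)%type) phi mu).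

(** Equal first coordinates put the points in the forward invariant cone of (A). There the distance
    of the second coordinates is at most [lu] times that of the images, while a leaf lets distances
    grow only by [mu]; as [lu * mu <= rho < 1], they agree. *)
Lemma leaf_eq i (z z' : X i * Y i) : leafZ z z' -> z.1 = z'.1 -> z = z'.
Proof.
move=> [C zz'] e; suff e2 : z.2 = z'.2.
  by case: z z' e e2 {zz'} => ? ? [? ?] /= -> ->.
apply: mdist_positivity; apply/eqP; rewrite eq_le mdist_ge0 andbT.
apply: (@geometric_le0 _ rho C) (hyp_rho01 H) _ => n.
have C0 : 0 <= C by exact: le_trans (mdist_ge0 _ _) (zz' 0).
move: (zz' n) => {zz'}.
have : mdist z.1 z'.1 <= alpha i * mdist z.2 z'.2 by rewrite e mdistxx mulr_ge0.
elim: n i C z z' {e} C0 => [|n IH] i C z z' /= C0 hz.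
  by rewrite expr0 mul1r mdist_pair ge_max => /andP[].
have [h1 h2] := hyp_A hz.
have Cmu : 0 <= C * mu i by rewrite mulr_ge0 ?(ltW (hyp_mu H i)).
move=> /(IH _ _ _ _ Cmu) h3.
have {h3} : mdist (phi z).2 (phi z').2 <= rho ^+ n * (C * mu i).
  by apply: h3; apply: le_trans h1 _; rewrite ler_wpM2r ?md0// (hyp_alpha_mono H).
move=> /(ler_wpM2l (lu0 i)) h3; apply: le_trans h2 (le_trans h3 _).
have -> : lu i * (rho ^+ n * (C * mu i)) = lu i * mu i * (rho ^+ n * C) by ring.
by rewrite exprS -(mulrA rho) ler_wpM2r ?(hyp_rho H)// mulr_ge0 ?exprn_ge0.
Qed.

(** * Points tracking a pseudo-invariant section *)

Section pseudo_orbit.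
Context (r : forall i, X i * Y i) (eta : I -> R) (theta : R).
Hypothesis eta0 : forall i, 0 <= eta i.
Hypothesis eta_s : forall i, eta (s i) = eta i.
Hypothesis theta1 : 1 < theta.
Hypothesis theta_mu : forall i, theta <= mu i.
Hypothesis r_pseudo : forall i, exists y x',
  [/\ phi ((r i).1, y) = (x', (r (s i)).2), mdist x' (r (s i)).1 <= eta i &
      mdist y (r i).2 <= eta i].

(** Comparison with the point [((r i).1, y)] leaves an error [B * V + eta i] where
    [(1 - kappa) * V <= B * eta i + t]; [K] bounds it by a multiple of [eta i + t]. *)
Let K := 1 + (1 - kappa)^-1 * (B * (B + 1)).

Let pseudo_step i (g : X (s i) -> Y (s i)) t : lip g -> 0 <= t ->
  mdist (g (r (s i)).1) (r (s i)).2 <= t ->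
  mdist (graph_transform g (r i).1) (r i).2 <= K * (eta i + t) /\
  mdist (phi ((r i).1, graph_transform g (r i).1)).1 (r (s i)).1 <= K * (eta i + t).
Proof.
move=> gl t0 gt; have [y [x' [e ex ey]]] := r_pseudo i.
have [|h1 h2] := graph_cmp (z' := ((r i).1, y)) gl (graph_transformP gl (r i).1).
  by rewrite mdistxx mulr_ge0.
rewrite e /=; rewrite e /= in h1 h2; move: h1 h2.
set V := mdist _ (r (s i)).2; set u := mdist (graph_transform _ _) y.
set w := mdist _ x' => h1 h2 h3.
have v0 : 0 <= (1 - kappa)^-1 by rewrite invr_ge0 ltW.
have V0 : 0 <= V by exact: mdist_ge0.
have : (1 - kappa) * V <= B * eta i + t.
  apply: le_trans h3 _; apply: le_trans (mdist_tri _ (g (r (s i)).1) _) _.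
  rewrite lerD//; apply: le_trans (gl _ _) _.
  by rewrite ler_pM ?md0.
rewrite -ler_pdivlMl// => hV.
have hBV : B * V + eta i <= K * (eta i + t).
  have := ler_wpM2l B0 hV; rewrite /K; move: (_^-1) v0 => v v0 h.
  have : 0 <= v * (B * (eta i + B * t)).
    by rewrite !mulr_ge0// addr_ge0// mulr_ge0.
  lra.
have := ler_wpM2r V0 (luB i); have := ler_wpM2r V0 (alphaB i) => h4 h5.
split; apply: le_trans hBV.
  by apply: le_trans (mdist_tri _ y _) _; rewrite lerD//; apply: le_trans h1 _.
by apply: le_trans (mdist_tri _ x' _) _; rewrite lerD//; apply: le_trans h2 _.
Qed.

Let K1 : 1 <= K.
Proof. by rewrite lerDl !mulr_ge0 ?invr_ge0 ?(ltW kappa1)// addr_ge0. Qed.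

Let K0 : 0 <= K := le_trans ler01 K1.

(** As [eta] is constant along orbits, one step adds an error of at most [K * (1 + tau) * eta i].
    Since [mu i] is at least [theta > 1], the growth of the summand [a * eta i] absorbs it. *)
Let pseudo_drift (tau a : R) : 0 <= tau -> K * (1 + tau) <= (theta - 1) * a ->
  drift r (fun i => tau * eta i) (fun i => a * eta i).
Proof.
move=> tau0 Ka i g gl gt z e; rewrite eta_s in gt *.
have [_ h1] := pseudo_step gl (mulr_ge0 tau0 (eta0 i)) gt.
have [_ h2] := graph_step gl e (graph_transformP gl (r i).1).
have h3 := mdist_tri (phi z).1 (phi ((r i).1, graph_transform g (r i).1)).1
  (r (s i)).1.
have h4 := ler_wpM2r (md0 z.1 (r i).1) (lsmu i).
have h5 := ler_wpM2r (eta0 i) Ka.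
have a0 : 0 <= a * eta i.
  rewrite mulr_ge0// -(pmulr_rge0 (x := theta - 1)) ?subr_gt0//.
  by apply: le_trans Ka; rewrite (mulr_ge0 K0)// addr_ge0.
have h6 := ler_wpM2r a0 (theta_mu i).
move: h2 => /= h2; lra.
Qed.

Let crude n := iter n (fun t => K * (1 + t)) 0.

Let crude_mono n m : (n <= m)%N -> 0 <= crude n <= crude m.
Proof.
have c0 k : 0 <= crude k.
  by elim: k => [|k IH] //=; rewrite (mulr_ge0 K0)// addr_ge0.
rewrite c0 /=; elim: m => [|m IH]; first by rewrite leqn0 => /eqP ->.
rewrite leq_eqVlt => /orP[/eqP -> //|/IH /le_trans]; apply => /=.
have h1 := ler_wpM2r (addr_ge0 ler01 (c0 m)) K1; rewrite -/(crude m); lra.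
Qed.

Let crude_approx n i : mdist (approx r n (r i).1) (r i).2 <= crude n * eta i.
Proof.
elim: n i => [|n IH] i /=; first by rewrite mdistxx mul0r.
have c0 : 0 <= crude n by case/andP: (crude_mono (leqnn n)).
have h := IH (s i); rewrite eta_s in h.
have [h1 _] := pseudo_step (approx_lip r n (i := s i)) (mulr_ge0 c0 (eta0 i)) h.
apply: le_trans h1 _; rewrite -/(crude n); lra.
Qed.

(* One graph transform may increase the distance of the graphs to the
   pseudo-orbit, since lu / (1 - kappa) may exceed 1, but sufficiently many of
   them halve it. *)
Let approx_bounded : exists2 tau, 0 <= tau &
  forall n i, mdist (approx r n (r i).1) (r i).2 <= tau * eta i.
Proof.
have h0 : (0 : R) < 1 / 2 by lra.
have [N /(_ N.+1 (leqnSn N))] :=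
  geometric_small ((1 - kappa)^-1 * (1 + B)) (hyp_rho01 H) h0.
(* A positive [N] lets the induction below pass from [n] to the smaller index [n - N]. *)
move: (N.+1) (ltn0Sn N) => {}N N0 hN.
have [e0 _] := andP (crude_mono (leqnn N)); set e := crude N in e0.
(* [a] meets the requirement of [pseudo_drift] for [e], and [tau] solves
   [e + (a + tau) / 2 = tau]. *)
pose a := K * (1 + e) / (theta - 1); pose tau := 2 * e + a.
have th : 0 < theta - 1 by rewrite subr_gt0.
have a0 : 0 <= a.
  by rewrite mulr_ge0 ?invr_ge0 ?(ltW th)// (mulr_ge0 K0)// addr_ge0.
have tau0 : 0 <= tau by apply: addr_ge0 a0; apply: mulr_ge0 e0.
exists tau => // n; elim/ltn_ind: n => n IH i.
have [nN|Nn] := leqP n N.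
  apply: le_trans (crude_approx n i) _; rewrite ler_wpM2r//.
  have [_ h] := andP (crude_mono nN); move: h; rewrite -/e /tau; lra.
(* Only the first [N] approximations enter this drift, so the crude bound [e] suffices and [a] does
   not depend on [tau]. *)
have dr : drift r (fun i => e * eta i) (fun i => (a + tau) * eta i).
  apply: pseudo_drift => //; rewrite [leRHS]mulrDr.
  have : K * (1 + e) = (theta - 1) * a by rewrite /a [RHS]mulrC divfK ?gt_eqF.
  move=> ->; rewrite lerDl mulr_ge0//; exact: ltW.
have A0 j : 0 <= (a + tau) * eta j by apply: mulr_ge0 (eta0 j); apply: addr_ge0.
have EN k : (k < N)%N -> forall j, mdist (approx r k (r j).1) (r j).2 <= e * eta j.
  move=> kN j; apply: le_trans (crude_approx k j) _; rewrite ler_wpM2r//.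
  by have [_ h] := andP (crude_mono (ltnW kN)).
have Ej j : mdist (approx r (n - N) (r j).1) (r j).2 <= (a + tau) * eta j.
  apply: le_trans (IH _ _ j) _; last by rewrite ler_wpM2r// lerDr.
  by rewrite ltn_subrL N0 (leq_trans _ Nn)// (leq_trans N0).
have := approx_cmp A0 dr EN Ej (i := i) (xP := (r i).1) (xR := (r i).1).
rewrite subnKC 1?ltnW// mdistxx add0r => /(_ (mulr_ge0 (alpha0 i) (md0 _ _))).
rewrite -ler_pdivlMl// => h1.
have h3 := mdist_tri (approx r n (r i).1) (approx r N (r i).1) (r i).2.
have h4 := crude_approx N i; rewrite -/e in h4.
have h5 := ler_wpM2r (A0 i) (ltW hN).
move: h1 h5; rewrite /tau; set v := (1 - kappa)^-1 => h1 h5; lra.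
Qed.

Lemma tracking_pseudo_orbit i (x : X i) :
  exists y, tracking (Z := fun i => (X i * Y i)%type) phi mu r (x, y).
Proof.
have [tau tau0 bnd] := approx_bounded.
pose a := K * (1 + tau) / (theta - 1).
have th : 0 < theta - 1 by rewrite subr_gt0.
have a0 : 0 <= a by rewrite mulr_ge0 ?invr_ge0 ?(ltW th)// (mulr_ge0 K0)// addr_ge0.
have dr : drift r (fun i => tau * eta i) (fun i => (a + tau) * eta i).
  apply: pseudo_drift => //; rewrite [leRHS]mulrDr.
  have : K * (1 + tau) = (theta - 1) * a by rewrite /a [RHS]mulrC divfK ?gt_eqF.
  by move=> ->; rewrite lerDl mulr_ge0// ltW.
have A0 j : 0 <= (a + tau) * eta j by apply: mulr_ge0 (eta0 j); apply: addr_ge0.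
have TA j : tau * eta j <= (a + tau) * eta j by rewrite ler_wpM2r// lerDr.
have [f [fl fi fT]] := approx_limit A0 TA dr bnd.
exists (f i x); exact: tracking_graph A0 TA dr fl fi fT i x.
Qed.

End pseudo_orbit.

End core.

(** * Leaves as Lipschitz graphs *)

Section leaves.
Context {R : realType} {I : Type} {s : I -> I} {X Y : I -> completeMetricType R}
  {phi : forall i, X i * Y i -> X (s i) * Y (s i)}
  {alpha beta lu ls mu : I -> R} {kappa rho B : R}.
Hypothesis H : hyperbolic phi alpha beta lu ls mu kappa rho B.

Local Notation leafZ := (leaf (Z := fun i => (X i * Y i)%type) phi mu).

(* Indexing the system by pointed fibers turns every point into the value of
   an exactly invariant section. *)
Let J := {i & (X i * Y i)%type}.
Let sJ (t : J) : J := existT _ (s (tag t)) (phi (tagged t)).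
Let XJ (t : J) := X (tag t).
Let YJ (t : J) := Y (tag t).
Let phiJ (t : J) : XJ t * YJ t -> XJ (sJ t) * YJ (sJ t) := @phi (tag t).
Let rJ (t : J) : XJ t * YJ t := tagged t.

Let HJ : hyperbolic (s := sJ) (X := XJ) (Y := YJ) phiJ (alpha \o tag) (beta \o tag)
  (lu \o tag) (ls \o tag) (mu \o tag) kappa rho B.
Proof.
case: H => -[hS hA hB] *; split=> //; try by case=> i z; rewrite /=; auto.
by split; case=> i z; [exact: hS|exact: hA|exact: hB].
Qed.

(** The orbit of [z] is an exactly invariant section through which all approximating graphs pass.
    Hence [approx_limit] applies with vanishing [T] and [A], even where [mu] is below 1. *)
Lemma leaf_graph i (z : X i * Y i) : exists f : X i -> Y i,
  [/\ forall x x', mdist (f x) (f x') <= beta i * mdist x x', f z.1 = z.2 &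
      forall x, leafZ z (x, f x)].
Proof.
have A0 (t : J) : (0 : R) <= 0 by [].
have drJ : drift (beta := beta \o tag) (mu := mu \o tag) (phi := phiJ) rJ
  (fun=> 0) (fun=> 0).
  move=> t g gl; rewrite le_eqVlt ltNge mdist_ge0 orbF.
  move=> /eqP/mdist_positivity gr w e.
  rewrite !addr0.
  have [_ h] := graph_step HJ gl e (esym gr : (phiJ (rJ t)).2 = _).
  apply: le_trans h _; rewrite ler_wpM2r ?mdist_ge0//.
  by case/andP: (hyp_ls HJ t).
have E n t : mdist (approx (phi := phiJ) rJ n (rJ t).1) (rJ t).2 <= 0.
  elim: n t => [|n IH] t /=; first by rewrite mdistxx.
  have al := approx_lip HJ rJ n (i := sJ t).
  have [|h1 _ h2] := graph_cmp HJ (z' := rJ t) al (graph_transformP HJ al (rJ t).1).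
    by rewrite mdistxx mulr_ge0 ?mdist_ge0//; case/andP: (hyp_alpha HJ t).
  apply: le_trans h1 _; rewrite mulr_ge0_le0//; first by case/andP: (hyp_lu HJ t).
  rewrite -(pmulr_rle0 (x := 1 - kappa)) ?subr_gt0 ?(hyp_kappa1 H)//.
  exact: le_trans h2 (IH (sJ t)).
have [f [fl fi fT]] := approx_limit HJ A0 (fun t => lexx 0) drJ E.
exists (f (existT _ i z)); split=> [||x]; first exact: (fl (existT _ i z)).
  apply: mdist_positivity; apply/eqP; rewrite eq_le mdist_ge0 andbT.
  exact: (fT (existT _ i z)).
have [C hC] := tracking_graph HJ A0 (fun t => lexx 0) drJ fl fi fT
  (i := existT _ i z) x.
exists C => n; move: (hC n).
suff trk t (w : XJ t * YJ t) c : track phiJ (mu \o tag) rJ n c w ->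
  grow (Z := fun i => (X i * Y i)%type) phi mu n c (tagged t) w by exact: trk.
by elim: n t w c => [|n IH] t w c /=; [rewrite metric_sym|move=> /IH].
Qed.

(** By [leaf_eq], [z'] lies on the Lipschitz graph through [z]. *)
Lemma leaf_cone i (z z' : X i * Y i) : leafZ z z' ->
  mdist z.2 z'.2 <= beta i * mdist z.1 z'.1.
Proof.
have [f [fl fz fL]] := leaf_graph z => zz'.
have <- : (z'.1, f z'.1) = z'.
  by apply: (leaf_eq H) => //; exact: leaf_trans (leaf_sym (fL _)) zz'.
by rewrite -fz; exact: fl.
Qed.

End leaves.
(** * Decoupling by invariant equivalence relations *)

Section decoupling.
Context {M : Type} {u : M -> M} {Xs Xc Xu : M -> Type}.
Let X m := (Xs m * Xc m * Xu m)%type.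
Context {phi : forall m, X m -> X (u m)} {Rcs Rs Ru : forall m, X m -> X m -> Prop}
  {L : forall m, X m -> Prop}.
Context (s0 : forall m, Xs m) (c0 : forall m, Xc m).

Hypotheses (Rcs_sym : forall m (z z' : X m), Rcs z z' -> Rcs z' z)
  (Rcs_trans : forall m (z1 z2 z3 : X m), Rcs z1 z2 -> Rcs z2 z3 -> Rcs z1 z3)
  (Rcs_step : forall m (z z' : X m), Rcs z z' -> Rcs (phi z) (phi z'))
  (Rcs_graph : forall m (z : X m) w, exists b, Rcs z (w, b))
  (Rcs_inj : forall m (z z' : X m), Rcs z z' -> z.1 = z'.1 -> z = z').
Hypotheses (Rs_sym : forall m (z z' : X m), Rs z z' -> Rs z' z)
  (Rs_trans : forall m (z1 z2 z3 : X m), Rs z1 z2 -> Rs z2 z3 -> Rs z1 z3)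
  (Rs_step : forall m (z z' : X m), Rs z z' -> Rs (phi z) (phi z'))
  (Rs_graph : forall m (z : X m) a, exists c b, Rs z (a, c, b))
  (Rs_inj : forall m (z z' : X m), Rs z z' -> z.1.1 = z'.1.1 -> z = z')
  (Rs_sub : forall m (z z' : X m), Rs z z' -> Rcs z z').
Hypotheses (Ru_sym : forall m (z z' : X m), Ru z z' -> Ru z' z)
  (Ru_trans : forall m (z1 z2 z3 : X m), Ru z1 z2 -> Ru z2 z3 -> Ru z1 z3)
  (Ru_step : forall m (z z' : X m), Ru z z' -> Ru (phi z) (phi z'))
  (meet : forall m (z w : X m), exists p, Ru z p /\ Rcs w p)
  (meet_inj : forall m (z z' : X m), Ru z z' -> Rcs z z' -> z = z').
Hypotheses (L_ex : forall m, exists z : X m, L z)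
  (L_Rcs : forall m (z z' : X m), L z -> L z' -> Rcs z z')
  (Rcs_L : forall m (z z' : X m), Rcs z z' -> L z -> L z')
  (L_step : forall m (z : X m), L z -> L (phi z)).

(** The label of a cs-class: its height over the reference point [(s0 m, c0 m)]. *)
Let b m (z : X m) : Xu m := projT1 (cid (Rcs_graph z (s0 m, c0 m))).
Let bP m (z : X m) : Rcs z (s0 m, c0 m, b z). Proof. by rewrite /b; case: cid. Qed.

Let b_eq m (z z' : X m) : Rcs z z' -> b z = b z'.
Proof.
move=> zz'; have : (s0 m, c0 m, b z) = (s0 m, c0 m, b z') by apply: Rcs_inj => //;
  exact: Rcs_trans (Rcs_sym (bP z)) (Rcs_trans zz' (bP z')).
by case.
Qed.

(** The label of an s-class: the c-coordinate of its point over [s0 m]. *)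
Let c m (z : X m) : Xc m := projT1 (cid (Rs_graph z (s0 m))).
Let cP m (z : X m) : exists b', Rs z (s0 m, c z, b').
Proof. by rewrite /c; case: cid. Qed.

Let c_eq m (z z' : X m) : Rs z z' -> c z = c z'.
Proof.
move=> zz'; have [d dP] := cP z; have [d' dP'] := cP z'.
have : (s0 m, c z, d) = (s0 m, c z', d') by apply: Rs_inj => //;
  exact: Rs_trans (Rs_sym dP) (Rs_trans zz' dP').
by case.
Qed.

Let p_ex m (z : X m) : exists p, Ru z p /\ L p.
Proof.
have [w Lw] := L_ex m; have [p [zp wp]] := meet z w.
by exists p; split=> //; exact: Rcs_L wp Lw.
Qed.

Let p m (z : X m) : X m := projT1 (cid (p_ex z)).
Let pP m (z : X m) : Ru z (p z) /\ L (p z). Proof. by rewrite /p; case: cid. Qed.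

Let p_eq m (z w : X m) : Ru z w -> L w -> p z = w.
Proof.
move=> zw Lw; have [zp Lp] := pP z.
by apply: meet_inj (L_Rcs Lp Lw); exact: Ru_trans (Ru_sym zp) zw.
Qed.

(** Start at the point of [L] over [(s0 m, ac.2)] and move along its s-class, which stays inside
    [L], to the s-coordinate [ac.1]. *)
Let r_ex m (ac : Xs m * Xc m) : exists r, [/\ L r, r.1.1 = ac.1 & c r = ac.2].
Proof.
have [w Lw] := L_ex m; have [d qP] := Rcs_graph w (s0 m, ac.2).
have [c' [d' rP]] := Rs_graph (s0 m, ac.2, d) ac.1.
exists (ac.1, c', d'); split=> //.
  by apply: Rcs_L Lw; exact: Rcs_trans qP (Rs_sub rP).
have [d'' ] := cP (ac.1, c', d'); move/(Rs_trans rP) => e.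
by have /(_ erefl) [] := Rs_inj e.
Qed.

Let r m ac : X m := projT1 (cid (r_ex ac)).
Let rP m (ac : Xs m * Xc m) : [/\ L (r ac), (r ac).1.1 = ac.1 & c (r ac) = ac.2].
Proof. by rewrite /r; case: cid. Qed.

(** The points of the two s-classes over [s0 m] both lie in the cs-class [L] and share their first
    two coordinates, hence coincide. *)
Let L_inj m (z z' : X m) : L z -> L z' -> c z = c z' -> Rs z z'.
Proof.
move=> Lz Lz' cc; have [d dP] := cP z; have [d' dP'] := cP z'.
rewrite -cc in dP'; apply: (Rs_trans dP); apply: Rs_sym.
suff <- : (s0 m, c z, d') = (s0 m, c z, d) by [].
apply: Rcs_inj => //; apply: Rcs_trans (Rcs_sym (Rs_sub dP')) _.
exact: Rcs_trans (L_Rcs Lz' Lz) (Rs_sub dP).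
Qed.

Let r_eq m (z : X m) : L z -> r (z.1.1, c z) = z.
Proof.
by move=> Lz; have [Lr r1 rc] := rP (z.1.1, c z); apply: Rs_inj => //; exact: L_inj.
Qed.

Let Pi m (z : X m) : X m := ((p z).1.1, c (p z), b z).

Lemma decoupling : exists
    (hs : forall m, Xs m * Xc m -> Xs (u m))
    (hu : forall m, Xc m * Xu m -> Xu (u m)) (hc : forall m, Xc m -> Xc (u m))
    (Pi : forall m, X m -> X m),
  (forall m, bijective (Pi m)) /\
  forall m (z : X m), Pi (u m) (phi z) =
    (hs m ((Pi m z).1.1, (Pi m z).1.2), hc m (Pi m z).1.2,
     hu m ((Pi m z).1.2, (Pi m z).2)).
Proof.
(* Each map applies [phi] to a representative with the given labels and reads off the new coordinate
   or label. *)
exists (fun m ac => (phi (r ac)).1.1), (fun m cb => b (phi (s0 m, c0 m, cb.2))),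
  (fun m d => c (phi (r (s0 m, d)))), Pi; split=> [m|m z].
  rewrite -setTT_bijective; split=> // [z z' _ _|[[a d] e] _].
    move=> [e1 e2 e3]; have [zp Lp] := pP z; have [zp' Lp'] := pP z'.
    have ep : p z = p z' by rewrite -(r_eq Lp) -(r_eq Lp') e1 e2.
    apply: meet_inj; first by apply: Ru_trans zp _; rewrite ep; exact: Ru_sym.
    by apply: Rcs_trans (bP z) _; rewrite e3; exact: Rcs_sym.
  have [Lr r1 rc] := rP (a, d).
  (* The preimage is the point where the u-class of [r (a, d)] meets the cs-class labelled [e]. *)
  have [z [rz ez]] := meet (r (a, d)) (s0 m, c0 m, e).
  exists z => //; rewrite /Pi (p_eq (Ru_sym rz) Lr) r1 rc; congr (_, _).
  have /(_ erefl) [] := Rcs_inj (Rcs_trans ez (bP z)).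
  by move=> <-.
(* [phi] preserves u-classes and [L], hence commutes with [p]. *)
have [zp Lp] := pP z; rewrite /Pi /= (p_eq (Ru_step zp) (L_step Lp)) (r_eq Lp).
congr (_, _, _); last by apply: b_eq; exact/Rcs_step/bP.
have [Lr r1 rc] := rP (s0 m, c (p z)).
by apply: c_eq; apply: Rs_step; apply: L_inj.
Qed.

End decoupling.

(** * Inverting a fiberwise bijection over an invertible base map *)

Section time_reversal.
Context {M : Type} {u v : M -> M} (uI : injective u) (vK : cancel v u).

Lemma existT_inj (Z : M -> Type) m (z z' : Z m) :
  existT Z m z = existT Z m z' -> z = z'.
Proof.
by move=> e; have := projT2_eq e; rewrite (Prop_irrelevance (projT1_eq e) erefl).
Qed.

Lemma existT_transport (Z : M -> Type) (P : forall m, Z m -> Z m -> Prop)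
    p q (w w' : Z p) (z z' : Z q) :
  existT Z p w = existT Z q z -> existT Z p w' = existT Z q z' ->
  P p w w' -> P q z z'.
Proof.
move=> e e'; have pq := existT_inj1 e; case: _ / pq z z' e e' => z z' e e'.
by rewrite (existT_inj e) (existT_inj e').
Qed.

Context {Z : M -> Type} {phi : forall m, Z m -> Z (u m)}.
Hypothesis phi_bij : forall m, bijective (@phi m).

(** Dependent pairs are compared because the fibers over [u (v m)] and [m] agree only along a proof
    of [u (v m) = m]. *)
Lemma reverse_ex m (z : Z m) :
  exists w : Z (v m), existT Z (u (v m)) (phi w) = existT Z m z.
Proof.
have : forall p q, u p = q -> forall z : Z q,
    exists w : Z p, existT Z (u p) (phi w) = existT Z q z.
  by move=> p q <- z'; have [g _ gK] := phi_bij p; exists (g z'); rewrite gK.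
exact.
Qed.

Definition reverse m (z : Z m) : Z (v m) := projT1 (cid (reverse_ex z)).

Lemma reverseE m (z : Z m) : existT Z (u (v m)) (phi (reverse z)) = existT Z m z.
Proof. by rewrite /reverse; case: cid. Qed.

Lemma existT_phi_inj p q (w : Z p) (z : Z q) :
  existT Z (u p) (phi w) = existT Z (u q) (phi z) -> existT Z p w = existT Z q z.
Proof.
move=> e; have pq := uI (existT_inj1 e); case: _ / pq z e => z e.
by rewrite (bij_inj (phi_bij p) (existT_inj e)).
Qed.

Lemma reverse_phi m (z : Z m) : existT Z (v (u m)) (reverse (phi z)) = existT Z m z.
Proof. by apply: existT_phi_inj; exact: reverseE. Qed.

Lemma phi_reverse m (z : Z m) w :
  existT Z (u (v m)) (phi w) = existT Z m z -> reverse z = w.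
Proof.
move=> e; apply: (bij_inj (phi_bij _)); apply: existT_inj.
by rewrite reverseE.
Qed.

End time_reversal.

(** * Trichotomies *)

Definition swap (A B : Type) (z : A * B) : B * A := (z.2, z.1).

Definition assoc (A B C : Type) (z : A * B * C) : A * (B * C) :=
  (z.1.1, (z.1.2, z.2)).

Definition unassoc (A B C : Type) (z : A * (B * C)) : A * B * C :=
  (z.1, z.2.1, z.2.2).

Section dichotomies.
Context {R : realType} {M : Type}.
Implicit Types X Y : M -> completeMetricType R.

Lemma dichotomy_of_AB (u : M -> M) X Y
    (H : bundle_correspondence u (prod_bundle X Y) (prod_bundle X Y)) F G
    (phi : forall m, X m * Y m -> X (u m) * Y (u m)) alpha lu beta ls :
  generating_bundle_map H F G -> AB_condition alpha lu beta ls H ->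
  (forall m, Graph (H m) = map_graph (phi m)) ->
  dichotomy phi alpha beta lu ls.
Proof.
move=> gen AB HE.
have gr m (z : X m * Y m) : Graph (H m) (z.1, z.2, ((phi m z).1, (phi m z).2)).
  by rewrite HE /map_graph /= -!surjective_pairing.
split=> [m x y'|m z z' h|m z z' h].
- have /(gen m x _ _ y') :=
    conj (erefl (G m (x, y'))) (erefl (F m (x, y'))).
  by rewrite HE /map_graph /= => e; exists (G m (x, y')), (F m (x, y')).
- exact: (AB m).1 (gr m z) (gr m z') h.
- exact: (AB m).2 (gr m z) (gr m z') h.
Qed.

(** Time reversal exchanges the two coordinates and with them the conditions (A) and (B); the rates
    over [m] are those of the step from [v m] to [m]. *)
Lemma dichotomy_reverse (u v : M -> M) (vK : cancel v u) X Y
    (phi : forall m, X m * Y m -> X (u m) * Y (u m))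
    (phi_bij : forall m, bijective (phi m)) alpha beta lu ls :
  dichotomy phi alpha beta lu ls ->
  dichotomy (s := v) (X := Y) (Y := X)
    (fun m z => swap (reverse vK phi_bij (swap z)))
    (beta \o v) (alpha \o v) (ls \o v) (lu \o v).
Proof.
move=> [solve condA condB].
have cast p q (e : u p = q) :
  [/\ forall (y : Y q) (x' : X p), exists x y',
        existT (fun m => X m * Y m)%type (u p) (phi p (x', y')) = existT _ q (x, y),
      forall (w w' : X p * Y p) z z',
        existT _ (u p) (phi p w) = existT (fun m => X m * Y m)%type q z ->
        existT _ (u p) (phi p w') = existT (fun m => X m * Y m)%type q z' ->
        mdist w.1 w'.1 <= alpha p * mdist w.2 w'.2 ->
        mdist z.1 z'.1 <= alpha p * mdist z.2 z'.2 /\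
        mdist w.2 w'.2 <= lu p * mdist z.2 z'.2 &
      forall (w w' : X p * Y p) z z',
        existT _ (u p) (phi p w) = existT (fun m => X m * Y m)%type q z ->
        existT _ (u p) (phi p w') = existT (fun m => X m * Y m)%type q z' ->
        mdist z.2 z'.2 <= beta p * mdist z.1 z'.1 ->
        mdist w.2 w'.2 <= beta p * mdist w.1 w'.1 /\
        mdist z.1 z'.1 <= ls p * mdist w.1 w'.1].
  case: _ / e; split=> [y x'|w w' z z' e e'|w w' z z' e e'].
  - by have [y' [x e]] := solve p x' y; exists x, y'; rewrite e.
  - by rewrite -(existT_inj e) -(existT_inj e'); exact: condA.
  - by rewrite -(existT_inj e) -(existT_inj e'); exact: condB.
split=> [m y x'|m z z'|m z z'].
- have [cs _ _] := cast _ _ (vK m); have [x [y' e]] := cs y x'.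
  by exists x, y'; rewrite /swap /= (phi_reverse _ _ e).
- have [_ _ cB] := cast _ _ (vK m) => h.
  exact: cB (reverseE vK phi_bij (swap z)) (reverseE vK phi_bij (swap z')) h.
- have [_ cA _] := cast _ _ (vK m) => h.
  exact: cA (reverseE vK phi_bij (swap z)) (reverseE vK phi_bij (swap z')) h.
Qed.

Lemma bounded_nonnegP (f : M -> R) : bounded_nonneg f ->
  exists2 b, 0 <= b & forall m, 0 <= f m <= b.
Proof.
move=> [f0 [b bP]]; exists (Num.max b 0); first by rewrite le_max lexx orbT.
by move=> m; rewrite f0 le_max bP//; exists m.
Qed.

Lemma sup_range_lt1 (f : M -> R) : (exists b, forall m, f m <= b) ->
  sup (range f) < 1 -> exists2 r, 0 <= r < 1 & forall m, f m <= r.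
Proof.
move=> [b bP] f1; exists (Num.max (sup (range f)) 0).
  by rewrite le_max lexx orbT gt_max f1 ltr01.
move=> m; rewrite le_max; apply/orP; left.
apply: sup_upper_bound; last by exists m.
by split; [exists (f m), m|exists b => _ [k _ <-]].
Qed.

Lemma sup_range_mul_lt1 (f g : M -> R) : bounded_nonneg f -> bounded_nonneg g ->
  sup (range (fun m => f m * g m)) < 1 ->
  exists2 r, 0 <= r < 1 & forall m, f m * g m <= r.
Proof.
move=> /bounded_nonnegP[b b0 bP] /bounded_nonnegP[c c0 cP]; apply: sup_range_lt1.
exists (b * c) => m; have /andP[? ?] := bP m; have /andP[? ?] := cP m.
exact: ler_pM.
Qed.

(* Only for a positive rate is the leaf relation reflected by the dynamics,
   whence the maximum with [e]. *)
Lemma rate_small (a b : M -> R) l r : 0 <= l -> 0 <= r < 1 ->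
  (forall m, 0 <= a m <= l) -> (forall m, a m * b m <= r) ->
  exists e rho, [/\ 0 < e <= 1, 0 <= rho < 1 &
    forall m, a m * Num.max (b m) e <= rho].
Proof.
move=> l0 /andP[r0 r1] al abr; exists (2 * (l + 1))^-1, (Num.max r 2^-1).
have l1 : 0 < 2 * (l + 1) by lra.
split.
- by rewrite invr_gt0 l1 invf_le1//; lra.
- by rewrite le_max r0 gt_max r1; lra.
- move=> m; have /andP[a0 am] := al m; rewrite maxr_pMr// ge_max !le_max abr /=.
  apply/orP; right; rewrite ler_pdivrMr//; lra.
Qed.

(** Tracking a pseudo-invariant section demands a rate above 1. The gap between [l] and 1 leaves
    room for it: [l * theta = 2 * l / (l + 1) < 1]. *)
Lemma rate_large (a b : M -> R) l r : 0 <= l < 1 -> 0 <= r < 1 ->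
  (forall m, 0 <= a m <= l) -> (forall m, a m * b m <= r) ->
  exists theta rho, [/\ 1 < theta, 0 <= rho < 1 &
    forall m, a m * Num.max (b m) theta <= rho].
Proof.
move=> /andP[l0 l1] /andP[r0 r1] al abr.
have l2 : 0 < l + 1 by lra.
exists (2 / (l + 1)), (Num.max r (2 * l / (l + 1))); split.
- by rewrite ltr_pdivlMr//; lra.
- by rewrite le_max r0 gt_max r1 ltr_pdivrMr//; lra.
- move=> m; have /andP[a0 am] := al m; rewrite maxr_pMr// ge_max !le_max abr /=.
  by apply/orP; right; rewrite mulrA ler_pM2r ?invr_gt0//; lra.
Qed.

End dichotomies.

(** The max metric is associative, so regrouping preserves distances. This places s-leaves inside
    cs-leaves. *)
Lemma grow_unassoc (R : realType) (M : Type) (u : M -> M)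
    (Xs Xc Xu : M -> completeMetricType R)
    (phi : forall m, Xs m * Xc m * Xu m -> Xs (u m) * Xc (u m) * Xu (u m))
    (mu mu' : M -> R) : (forall m, 0 < mu m) -> (forall m, mu m <= mu' m) ->
  forall n C C' m z z', 0 <= C -> C <= C' ->
  grow (Z := fun m => (Xs m * (Xc m * Xu m))%type)
    (fun m z => assoc (phi m (unassoc z))) mu n C (assoc z) (assoc z') ->
  @grow _ _ u (fun m => (Xs m * Xc m * Xu m)%type) phi mu' n C' m z z'.
Proof.
move=> mu0 mumu; elim=> [|n IH] C C' m z z' C0 CC' /=.
  by move=> h; apply: le_trans CC'; move: h; rewrite !mdist_pair /= maxA.
case: z z' => [[a c] b] [[a' c'] b']; apply: IH; first by rewrite mulr_ge0// ltW.
by rewrite ler_pM// ltW.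
Qed.

Theorem corollary4p19 (R : realType) (M : Type) (u : M -> M)
    (u_inv : bijective u)
    (Xs Xc Xu : M -> completeMetricType R)
    (H : bundle_correspondence u (bundle_scu Xs Xc Xu) (bundle_scu Xs Xc Xu))
    (Fcs : forall m, bundle_cs Xs Xc m * Xu (u m) -> bundle_cs Xs Xc (u m))
    (Gcs : forall m, bundle_cs Xs Xc m * Xu (u m) -> Xu m)
    (Fcu : forall m, Xs m * bundle_cu Xc Xu (u m) -> Xs (u m))
    (Gcu : forall m, Xs m * bundle_cu Xc Xu (u m) -> bundle_cu Xc Xu m)
    (alpha_u alpha_cu beta_s beta_cs
     lambda_u lambda_cu lambda_s lambda_cs : M -> R)
    (HT : trichotomy H Fcs Gcs Fcu Gcu alpha_u alpha_cu beta_s beta_cs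
            lambda_u lambda_cu lambda_s lambda_cs)
    (i_s : forall m, Xs m) (i_c : forall m, Xc m) (i_u : forall m, Xu m)
    (i_cs_u : pseudo_invariant1 Fcs Gcs (fun m => (i_s m, i_c m)) i_u)
    (i_s_cu : pseudo_invariant1 Fcu Gcu i_s (fun m => (i_c m, i_u m)))
    (H_inv : forall m, invertible_correspondence (H m)) :
  exists (hs : bundle_map u (bundle_cs Xs Xc) Xs)
         (hu : bundle_map u (bundle_cu Xc Xu) Xu)
         (hc : bundle_map u Xc Xc)
         (Pi : bundle_map id (bundle_scu Xs Xc Xu) (bundle_scu Xs Xc Xu)),
    (forall m, bijective (Pi m)) /\
    (forall m,
       (map_graph (Pi (u m)) \; Graph (H m))%relation =
       (map_graph (decoupled_map hs hc hu m) \; map_graph (Pi m))%relation).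
Proof.
have [v uK vK] := u_inv.
case: HT => -[genCs genCu ABcs ABcu] [[au acu] [bs bcs] [lu lcu] [ls lcs]].
move=> [_ _ alpha_mono beta_mono] [ordP sup_ab] [sup_ucs sup_u sup_cus sup_s].
pose phi m : Xs m * Xc m * Xu m -> Xs (u m) * Xc (u m) * Xu (u m) :=
  s2val (cid2 (H_inv m)).
have phi_bij m : bijective (@phi m) by exact: s2valP (cid2 (H_inv m)).
have phiE m : Graph (H m) = map_graph (@phi m) by exact: s2valP' (cid2 (H_inv m)).
pose phi2 m (z : Xs m * (Xc m * Xu m)) := assoc (phi m (unassoc z)).
have phi2E m : Graph (assoc_bundle_correspondence H m) = map_graph (phi2 m).
  apply/seteqP; split=> -[[a [c b]] [a' [c' b']]];
    rewrite /= /assoc_graph /= phiE /map_graph /phi2 /assoc /unassoc /=.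
    by move=> <-.
  by move=> [-> -> ->]; rewrite -!surjective_pairing.
have Dcs := dichotomy_of_AB (X := bundle_cs Xs Xc) (Y := Xu) genCs ABcs phiE.
have Ds := dichotomy_of_AB (X := Xs) (Y := bundle_cu Xc Xu) genCu ABcu phi2E.
have Du := dichotomy_reverse vK phi_bij Dcs.
have [k k01 kP] := sup_range_mul_lt1 au bs sup_ab.
have [b1 b10 auP] := bounded_nonnegP au; have [b2 b20 acuP] := bounded_nonnegP acu.
have [b3 b30 bsP] := bounded_nonnegP bs; have [b4 b40 bcsP] := bounded_nonnegP bcs.
have [b5 b50 luP] := bounded_nonnegP lu; have [b6 b60 lcuP] := bounded_nonnegP lcu.
have [b7 b70 lsP] := bounded_nonnegP ls; have [b8 b80 lcsP] := bounded_nonnegP lcs.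
pose B := b1 + b2 + b3 + b4 + b5 + b6 + b7 + b8.
have B0 : 0 <= B by rewrite /B; lra.
have leB x b : b <= B -> 0 <= x <= b -> 0 <= x <= B.
  by move=> bB /andP[-> /le_trans]; exact.
have [rcs rcs01 rcsP] := sup_range_mul_lt1 lu lcs sup_ucs.
have [rs rs01 rsP] := sup_range_mul_lt1 lcu ls sup_cus.
have [l l01 lP] : exists2 r, 0 <= r < 1 & forall m, lambda_u m <= r.
  by apply: sup_range_lt1 => //; exists b5 => m; case/andP: (luP m).
have [s s01 sP] : exists2 r, 0 <= r < 1 & forall m, lambda_s m <= r.
  by apply: sup_range_lt1 => //; exists b7 => m; case/andP: (lsP m).
have luP' m : 0 <= lambda_u m <= l by rewrite lP andbT; case/andP: (luP m).
have [theta [rho1 [theta1 rho1P mu1P]]] := rate_large l01 rcs01 luP' rcsP.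
have [e2 [rho2 [/andP[e20 e21] rho2P mu2P]]] := rate_small b60 rs01 lcuP rsP.
have rcsP' m : lambda_cs m * lambda_u m <= rcs by rewrite mulrC.
have [e3 [rho3 [/andP[e30 e31] rho3P mu3P]]] := rate_small b80 rcs01 lcsP rcsP'.
(* [mu1] exceeds 1 to absorb the errors of the pseudo-invariant section, [mu2] is at most 1 so that
   s-leaves lie in cs-leaves, and [mu3] is kept positive. *)
pose mu1 m := Num.max (lambda_cs m) theta.
pose mu2 m := Num.max (lambda_s m) e2.
pose mu3 m := Num.max (lambda_u (v m)) e3.
have k1 : k < 1 by case/andP: k01.
(* Through [beta_cs <= beta_s] and [alpha_cu <= alpha_u], the bound on [alpha_u * beta_s] serves all
   three systems. *)
have kcs m : alpha_u m * beta_cs m <= k.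
  apply: le_trans (kP m); rewrite ler_wpM2l//; first by case/andP: (auP m).
  by case: (ordP m).
have kcu m : alpha_cu m * beta_s m <= k.
  apply: le_trans (kP m); rewrite ler_wpM2r//; first by case/andP: (bsP m).
  by case: (ordP m).
have Hcs : hyperbolic (X := bundle_cs Xs Xc) (Y := Xu) phi alpha_u beta_cs lambda_u
    lambda_cs mu1 k rho1 B.
  split=> //.
  - by move=> m; apply: leB (auP m); rewrite /B; lra.
  - by move=> m; apply: leB (bcsP m); rewrite /B; lra.
  - by move=> m; apply: leB (luP m); rewrite /B; lra.
  - by move=> m; rewrite /mu1 le_max lexx andbT; case/andP: (lcsP m).
  - by move=> m; rewrite /mu1 lt_max (lt_trans ltr01 theta1) orbT.
  - by move=> m; case: (alpha_mono m).
  - by move=> m; case: (beta_mono m).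
have Hs : hyperbolic (X := Xs) (Y := bundle_cu Xc Xu) phi2 alpha_cu beta_s lambda_cu
    lambda_s mu2 k rho2 B.
  split=> //.
  - by move=> m; apply: leB (acuP m); rewrite /B; lra.
  - by move=> m; apply: leB (bsP m); rewrite /B; lra.
  - by move=> m; apply: leB (lcuP m); rewrite /B; lra.
  - by move=> m; rewrite /mu2 le_max lexx andbT; case/andP: (lsP m).
  - by move=> m; rewrite /mu2 lt_max e20 orbT.
  - by move=> m; case: (alpha_mono m).
  - by move=> m; case: (beta_mono m).
have Hu : hyperbolic (s := v) (X := Xu) (Y := bundle_cs Xs Xc)
    (fun m z => swap (reverse vK phi_bij (swap z))) (beta_cs \o v) (alpha_u \o v)
    (lambda_cs \o v) (lambda_u \o v) mu3 k rho3 B.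
  split=> //.
  - by move=> m; apply: leB (bcsP _); rewrite /B; lra.
  - by move=> m; apply: leB (auP _); rewrite /B; lra.
  - by move=> m; apply: leB (lcsP _); rewrite /B; lra.
  - by move=> m; rewrite /mu3 /= le_max lexx andbT; case/andP: (luP (v m)).
  - by move=> m; rewrite /mu3 lt_max e30 orbT.
  - by move=> m /=; case: (beta_mono (v (v m))); rewrite vK.
  - by move=> m /=; case: (alpha_mono (v (v m))); rewrite vK.
  - by move=> m /=; rewrite mulrC.
  - by move=> m; exact: mu3P.
pose Rcs m := @leaf _ _ u (fun m => bundle_cs Xs Xc m * Xu m)%type phi mu1 m.
pose Rs m (z z' : Xs m * Xc m * Xu m) :=
  leaf (Z := fun m => (Xs m * bundle_cu Xc Xu m)%type) phi2 mu2 (assoc z) (assoc z').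
pose Ru m (z z' : Xs m * Xc m * Xu m) :=
  leaf (Z := fun m => (Xu m * bundle_cs Xs Xc m)%type)
    (fun m z => swap (reverse vK phi_bij (swap z))) mu3 (swap z) (swap z').
pose r m : bundle_cs Xs Xc m * Xu m := (i_s m, i_c m, i_u m).
pose L m := @tracking _ _ u (fun m => bundle_cs Xs Xc m * Xu m)%type phi mu1 r m.
(* Over [m] a u-leaf has slope [alpha_u (v m)], taken from the preceding fiber; monotonicity keeps
   its product with [beta_cs m] at most [k]. *)
have a_v m : 0 <= alpha_u (v m) <= alpha_u m.
  have [+ _] := alpha_mono (v m); rewrite vK => ->; rewrite andbT.
  by case/andP: (auP (v m)).
have bcs0 m : 0 <= beta_cs m by case/andP: (bcsP m).
have ab_v m : beta_cs m * alpha_u (v m) <= k.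
  by apply: le_trans (kcs m); rewrite mulrC ler_wpM2r//; case/andP: (a_v m).
suff [hs [hu [hc [Pi [Pi_bij PiE]]]]] : exists
    (hs : forall m, Xs m * Xc m -> Xs (u m))
    (hu : forall m, Xc m * Xu m -> Xu (u m)) (hc : forall m, Xc m -> Xc (u m))
    (Pi : forall m, Xs m * Xc m * Xu m -> Xs m * Xc m * Xu m),
  (forall m, bijective (Pi m)) /\
  forall m z, Pi (u m) (phi m z) =
    (hs m ((Pi m z).1.1, (Pi m z).1.2), hc m (Pi m z).1.2,
     hu m ((Pi m z).1.2, (Pi m z).2)).
  exists hs, hu, hc, Pi; split=> // m; rewrite phiE; apply/seteqP.
  split=> -[x y] [z]; rewrite /map_graph /= => zE yE.
    by exists (Pi m x); rewrite //= yE zE PiE.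
  by exists (phi m x); rewrite //= yE zE PiE.
apply: (@decoupling _ _ _ _ _ _ Rcs Rs Ru L i_s i_c).
- by move=> m z z'; exact: leaf_sym.
- by move=> m z1 z2 z3; exact: leaf_trans.
- by move=> m z z' /(leaf_step _ (hyp_mu Hcs)).
- by move=> m z w; have [f [_ _ fP]] := leaf_graph Hcs z; exists (f w); exact: fP.
- by move=> m z z'; exact: leaf_eq Hcs _ _ _.
- by move=> m z z'; exact: leaf_sym.
- by move=> m z1 z2 z3; exact: leaf_trans.
- by move=> m [[a c] b] [[a' c'] b'] /(leaf_step _ (hyp_mu Hs)).
- move=> m z a; have [f [_ _ fP]] := leaf_graph Hs (assoc z).
  exists (f a).1, (f a).2; rewrite /Rs {2}/assoc /= -surjective_pairing.
  exact: fP.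
- move=> m [[a c] b] [[a' c'] b'] /(leaf_eq Hs) /= h e.
  by have [-> -> ->] := h e.
- move=> m z z' [C hC]; exists C => n.
  apply: (grow_unassoc (hyp_mu Hs)) (hC n) => //.
    move=> k'; apply: (le_trans (y := 1)); first by rewrite /mu2 ge_max e21 andbT;
      apply: le_trans (sP k') _; case/andP: s01 => _ /ltW.
    by rewrite /mu1 le_max (ltW theta1) orbT.
  exact: le_trans (mdist_ge0 _ _) (hC 0).
- by move=> m z z'; exact: leaf_sym.
- by move=> m z1 z2 z3; exact: leaf_trans.
(* u-leaves are defined by the inverse of [phi], which returns the images to [z] and [z']; hence the
   reflecting half of [leaf_step] is used. *)
- move=> m z z' zz'; apply/(leaf_step _ (hyp_mu Hu)) => /=.
  rewrite /swap -!surjective_pairing.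
  exact: (existT_transport (P := Ru) (esym (reverse_phi (can_inj uK) vK phi_bij z))
    (esym (reverse_phi (can_inj uK) vK phi_bij z'))).
- move=> m z w; have [f [fl _ fP]] := leaf_graph Hcs w.
  have [g [gl _ gP]] := leaf_graph Hu (swap z).
  (* The cs-leaf and the u-leaf cross at a fixed point of the contraction [f \o g]. *)
  have [y yP] : exists y, f (g y) = y.
    apply: contraction_fixpoint k01 _ => y y'; apply: le_trans (fl _ _) _.
    apply: le_trans (ler_wpM2l (bcs0 m) (gl _ _)) _.
    by rewrite mulrA ler_wpM2r ?mdist_ge0 ?ab_v.
  exists (g y, y); split; first exact: gP.
  by rewrite -{2}yP; exact: fP.
- move=> m z z' hu hcs; have h1 := leaf_cone Hu hu; have h2 := leaf_cone Hcs hcs.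
  suff e : z.2 = z'.2.
    have := leaf_eq Hu hu e.
    by rewrite /swap; case: z z' {hu hcs h1 h2 e} => ? ? [? ?] [-> ->].
  apply: mdist_positivity; apply/eqP; rewrite eq_le mdist_ge0 andbT.
  have := ler_wpM2l (bcs0 m) h1; have := ler_wpM2r (mdist_ge0 z.2 z'.2) (ab_v m).
  rewrite -(pmulr_rle0 (x := 1 - k)) ?subr_gt0//= ; move: h2 => /=.
  lra.
- case: i_cs_u => eta [eta0 etaP] m.
  have eta_s n : eta (u n) = eta n.
    by have [_ _ h1 h2] := etaP n; apply/eqP; rewrite eq_le h1 h2.
  have [n|n|y yP] := tracking_pseudo_orbit Hcs (r := r) eta0 eta_s theta1 _ _
    (i_s m, i_c m).
  + by rewrite /mu1 le_max lexx orbT.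
  + exists (Gcs n (i_s n, i_c n, i_u (u n))), (Fcs n (i_s n, i_c n, i_u (u n))).
    have [h1 h2 _ _] := etaP n; split;
      [|by rewrite mdistC -(eta_s n)|by rewrite mdistC].
    have /(genCs n (i_s n, i_c n) _ _ (i_u (u n))) :=
      conj (erefl (Gcs n (i_s n, i_c n, i_u (u n))))
      (erefl (Fcs n (i_s n, i_c n, i_u (u n)))).
    by rewrite phiE.
  + by exists (i_s m, i_c m, y).
- by move=> m z z'; exact: tracking_leaf.
- by move=> m z z'; exact: leaf_tracking.
- by move=> m z; exact: tracking_step.
Qed.
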